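(* Let $\mathbf{x}=(x_n)_{n\in\mathbb{N}}$ be a sequence in the Banach space $c_0$. Then $\mathcal{R}\leq_K\mathcal{B}(\mathbf{x})$ if and only if $(x_n)_n$ is weakly null.
   Context: $\mathcal{B}(\mathbf{x})$ is the family of all $A\subseteq\mathbb{N}$ for which there is $k>0$ such that $\|\sum_{n\in F}x_n\|\leq k$ for all finite $F\subseteq A$. $\mathcal{R}$ is the random ideal: the ideal on $\mathbb{N}$ generated by the cliques and independent sets of the random (Rado) graph on $\mathbb{N}$. $\mathcal{I}\leq_K\mathcal{J}$ (Katětov order) means there is $f:\mathbb{N}\to\mathbb{N}$ such that $f^{-1}(A)\in\mathcal{J}$ for all $A\in\mathcal{I}$. Weakly null means converging to $0$ in the weak topology. *)

(* Defs.v *)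
From HB Require Import structures.
From mathcomp Require Import all_boot all_order all_algebra finmap.
From mathcomp Require Import all_classical all_reals all_analysis.

Set Implicit Arguments.
Unset Strict Implicit.
Unset Printing Implicit Defensive.

Import Order.TTheory GRing.Theory Num.Theory.
Import numFieldNormedType.Exports.

Local Open Scope classical_set_scope.
Local Open Scope ring_scope.

Definition null_seq (R : realType) : {pred nat -> R} :=
  fun x => `[< x @ \oo --> (0 : R) >].

Lemma null_seq_submod_closed (R : realType) :
  submod_closed (@null_seq R : {pred nat -> R^o}).
Proof.
split; first by apply/asboolP; exact: cvg_cst.
move=> a x y /asboolP x0 /asboolP y0; apply/asboolP.
have -> : (0 : R) = a * 0 + 0 by rewrite mulr0 addr0.
by apply: cvgD => //; apply: cvgM => //; exact: cvg_cst.
Qed.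

HB.instance Definition _ (R : realType) :=
  GRing.isSubmodClosed.Build R (nat -> R^o) (@null_seq R)
    (@null_seq_submod_closed R).

Record c0 (R : realType) := C0 {
  c0_seq :> nat -> R^o ;
  c0_seqP : c0_seq \in @null_seq R }.

HB.instance Definition _ (R : realType) := [isSub for @c0_seq R].
HB.instance Definition _ (R : realType) := [Choice of c0 R by <:].
HB.instance Definition _ (R : realType) :=
  [SubChoice_isSubLmodule of c0 R by <:].

Section c0_norm.
Variable R : realType.
Implicit Types x y : c0 R.

Definition c0_norm x : R := sup (range (fun n => `|x n|)).

Lemma c0_cvg x : c0_seq x @ \oo --> (0 : R).
Proof. exact/asboolP/(c0_seqP x). Qed.

Lemma c0_has_sup x : has_sup (range (fun n => `|x n| : R)).
Proof.
split; first by exists `|x 0%N|, 0%N.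
have /cvg_seq_bounded[M [_ hM]] : cvgn (c0_seq x : R^nat).
  by apply/cvg_ex; exists 0; exact: c0_cvg.
exists (M + 1) => _ [n _ <-].
by apply: (hM (M + 1)) => //; rewrite ltrDl.
Qed.

Lemma c0_norm_ub x n : `|x n| <= c0_norm x.
Proof. by apply: (sup_upper_bound (c0_has_sup x)); exists n. Qed.

Lemma c0_norm_le x (k : R) : (forall n, `|x n| <= k) -> c0_norm x <= k.
Proof.
move=> xk; apply: ge_sup; first by exists `|x 0%N|, 0%N.
by move=> _ [n _ <-].
Qed.

Lemma c0_normD x y : c0_norm (x + y) <= c0_norm x + c0_norm y.
Proof.
apply: c0_norm_le => n.
by apply: le_trans (ler_normD (x n) (y n)) _; apply: lerD; exact: c0_norm_ub.
Qed.

Lemma c0_norm0_eq0 x : c0_norm x = 0 -> x = 0.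
Proof.
move=> x0; apply/val_inj/funext => n /=.
by apply/normr0_eq0/le_anti; rewrite normr_ge0 andbT -x0; exact: c0_norm_ub.
Qed.

Lemma c0_normZ (a : R) x : c0_norm (a *: x) = `|a| * c0_norm x.
Proof.
have le b z : c0_norm (b *: z) <= `|b| * c0_norm z.
  apply: c0_norm_le => n.
  have -> : (b *: z) n = b * z n by [].
  by rewrite normrM ler_wpM2l ?normr_ge0 ?c0_norm_ub.
apply/le_anti; rewrite le /=.
have [->|a0] := eqVneq a 0.
  by rewrite normr0 mul0r; exact: le_trans (c0_norm_ub _ 0%N).
rewrite -ler_pdivlMl ?normr_gt0// -normfV.
by rewrite -{1}[x](scalerK a0); exact: le.
Qed.

End c0_norm.

HB.instance Definition _ (R : realType) :=
  Lmodule_isNormed.Build R (c0 R)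
    (@c0_normD R) (@c0_normZ R) (@c0_norm0_eq0 R).

Lemma c0_normE (R : realType) (x : c0 R) :
  `|x| = sup (range (fun n => `|x n| : R)).
Proof. by []. Qed.

Lemma c0_complete (R : realType) (F : set_system (c0 R)) :
  ProperFilter F -> cauchy F -> cvg F.
Proof.
move=> FF cF.
have cF' (e : R) : 0 < e -> exists x : c0 R, F (ball x e).
  by move: cF => /cauchyP; exact.
pose l n : R := lim ((fun y : c0 R => y n : R) @ F).
have cl n : (fun y : c0 R => y n : R) @ F --> l n.
  apply: R_complete; apply: cauchy_exP => e e0.
  have [x Fx] := cF' e e0; exists (x n).
  change (F [set y : c0 R | ball (x n : R) e (y n : R)]).
  apply: (filterS (P := ball x e)) Fx => y.
  rewrite -ball_normE /ball_/= => xy.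
  exact: le_lt_trans (c0_norm_ub (x - y) n) xy.
have le (e : R) (x : c0 R) n : F (ball x e) -> `|x n - l n| <= e.
  move=> Fx.
  have : (fun y : c0 R => `|x n - y n| : R) @ F --> `|x n - l n|.
    by apply: cvg_norm; apply: cvgB (cl n); exact: cvg_cst.
  move=> /cvgr_to_le; apply; apply: filterS Fx => y.
  rewrite -ball_normE /ball_/= => /ltW xy.
  exact: le_trans (c0_norm_ub (x - y) n) xy.
have l0 : l \in @null_seq R.
  apply/asboolP/cvgrPdist_le => e e0.
  have e20 : 0 < e / 2 by rewrite divr_gt0.
  have [x Fx] := cF' _ e20.
  have /cvgrPdist_le/(_ _ e20) := c0_cvg x.
  apply: filterS => n; rewrite !sub0r !normrN => xn.
  have := le _ _ n Fx => ln.
  rewrite -(subKr (x n) (l n)) (splitr e).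
  by apply: le_trans (ler_normB _ _) _; exact: lerD.
apply/cvg_ex; exists (C0 l0); apply/cvgrPdist_le => e e0.
have e20 : 0 < e / 2 by rewrite divr_gt0.
have [x Fx] := cF' _ e20.
apply: filterS (Fx) => y; rewrite -ball_normE /ball_/= => /ltW xy.
apply: c0_norm_le => n.
have -> : (C0 l0 - y) n = (x - y) n - (x n - l n).
  change (l n - y n = x n - y n - (x n - l n)).
  by rewrite opprB [RHS]addrC subrKA.
rewrite (splitr e); apply: le_trans (ler_normB _ _) _.
apply: lerD; last exact: le.
exact: le_trans (c0_norm_ub (x - y) n) xy.
Qed.

HB.instance Definition _ (R : realType) :=
  Uniform_isComplete.Build (c0 R) (@c0_complete R).

Definition dual (R : realType) (V : normedModType R) :=
  {f : {linear V -> R^o} | continuous f}.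

Definition weak (R : realType) (V : normedModType R) : topologicalType :=
  sup_topology (fun f : dual V => Topological.on (initial_topology (sval f))).

Definition weakly_null (R : realType) (V : normedModType R) (x : nat -> V) :=
  (x : nat -> weak V) @ \oo --> ((0 : V) : weak V).

(* Neither properness nor containing the finite sets is required: [bsum x]
   contains [setT] when, e.g., [x = 0], and singletons, being cliques, belong to
   the random ideal anyway. *)
Definition is_ideal (I : set (set nat)) :=
  [/\ I set0,
      forall A B, A `<=` B -> I B -> I A &
      forall A B, I A -> I B -> I (A `|` B)].

Definition katetov_le (I J : set (set nat)) :=
  exists f : nat -> nat, forall A, I A -> J (f @^-1` A).

Definition bsum (R : realType) (V : normedModType R) (x : nat -> V)
    : set (set nat) :=
  [set A | exists2 k : R, 0 < k &
     forall F : {fset nat}, [set` F] `<=` A -> `|\sum_(n <- F) x n| <= k].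

Definition simple_graph (E : rel nat) := symmetric E /\ irreflexive E.

(* The extension property, which characterizes the random graph among the
   graphs on [nat] up to isomorphism. *)
Definition random_graph (E : rel nat) :=
  simple_graph E /\
  forall F G : {fset nat}, [disjoint F & G]%fset ->
    exists n, [/\ n \notin F, n \notin G,
      forall m, m \in F -> E n m & forall m, m \in G -> ~~ E n m].

Lemma random_graph_exists : exists E : rel nat, random_graph E.
Proof.
pose dec n : {fset nat} :=
  oapp fst fset0 (@choice.unpickle ({fset nat} * nat)%type n).
pose code (F : {fset nat}) k := choice.pickle (F, k : nat).
have decK F k : dec (code F k) = F by rewrite /dec /code choice.pickleK.
exists (fun m n => (m != n) && ((m \in dec n) || (n \in dec m))).
split.
  by split=> [m n|n]; rewrite ?eqxx// eq_sym orbC.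
move=> F G FG.
pose S := (F `|` G `|` \bigcup_(m <- (F `|` G)%fset) dec m)%fset.
have [k kS] : exists k, code F k \notin S.
  apply: contrapT => /forallNP h.
  have inS k : code F k \in S by apply: contrapT => /negP; exact: h.
  have inj : injective (code F) by move=> k l /(pcan_inj choice.pickleK)[].
  have : (size [seq code F k | k <- iota 0 (size S).+1] <= size S)%N.
    apply: uniq_leq_size; first by rewrite map_inj_uniq// iota_uniq.
    by move=> _ /mapP[k _ ->]; exact: inS.
  by rewrite size_map size_iota ltnn.
have nF : code F k \notin F by apply: contra kS; rewrite !inE => ->.
have nG : code F k \notin G by apply: contra kS; rewrite !inE => ->; rewrite orbT.
exists (code F k); split=> // m mF; rewrite decK.
  by rewrite mF orbT andbT; apply: contra nF => /eqP ->.
rewrite negb_and negb_or; apply/orP; right; apply/andP; split.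
  apply: contra kS => kd; rewrite !inE; apply/orP; right.
  apply/bigfcupP; exists m => //.
  by rewrite !inE mF orbT.
by apply/negP => /(fdisjointP FG); rewrite mF.
Qed.

Definition clique (E : rel nat) : set (set nat) :=
  [set A | forall m n, A m -> A n -> m != n -> E m n].

Definition independent (E : rel nat) : set (set nat) :=
  [set A | forall m n, A m -> A n -> m != n -> ~~ E m n].

Definition random_ideal (E : rel nat) : set (set nat) :=
  smallest is_ideal (clique E `|` independent E).

(* Main.v *)
Require Import Defs.
From mathcomp Require Import all_boot all_order all_algebra finmap.
From mathcomp Require Import all_classical all_reals all_analysis.
From HB Require Import structures.
From mathcomp Require Import ring lra.

(** A Katetov reduction [f] of the random ideal to an ideal [I] pulls the random
    graph back to a 2-colouring of the pairs of indices whose homogeneous sets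
    all lie in [I]; conversely, every such colouring arises in this way, because
    the random graph contains every countable graph ([embed_coloring]). So the
    theorem asks when there is a 2-colouring of the pairs of indices all of
    whose homogeneous sets [A] have bounded finite sums of [x_n], [n] in [A].

    If there is one, then [x] is weakly null, in any normed space
    ([weakly_null_of_katetov]). If it were not, some functional [phi] would
    satisfy [phi (x_n) >= e > 0] for infinitely many [n]; Ramsey's theorem
    ([infinite_ramsey]) would give an infinite homogeneous set of such [n],
    along which sums of [N] terms have norm at least a multiple of [N], so that
    they are unbounded.

    If [x] is weakly null in [c0], then it tends to [0] in each coordinate and it is
    bounded ([weakly_null_bounded], by a gliding hump). Give the pair [m < n]
    the first colour when, in every coordinate, [x_m] or [x_n] is at most [2^-m]
    in absolute value. For a fixed [m] only finitely many coordinates of [x_m]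
    exceed [2^-m], and there [x_n] is eventually small; hence almost every [n]
    forms a pair of the first colour with [m], and the sets homogeneous for the
    second colour are finite. If [A] is homogeneous for the first colour, then
    in each coordinate a term [x_n] above [2^-n] is at most [2^-m], where [m] is
    the index of the previous such term, so that the absolute values sum to at
    most [sup |x| + 2] ([sum_almost_disjoint]); in [c0] such a bound, uniform in
    the coordinate, is a bound on the norms of the sums. *)

Set Implicit Arguments.
Unset Strict Implicit.
Unset Printing Implicit Defensive.

Import Order.TTheory GRing.Theory Num.Theory.
Import numFieldNormedType.Exports.

Local Open Scope classical_set_scope.
Local Open Scope ring_scope.

(** * Ramsey's theorem and universality of the random graph *)

(** The form of dependent choice behind the three recursive constructions below
    (a homogeneous set, an embedding, a gliding hump), where each term depends on
    all the earlier ones. *)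
Lemma seq_of_finite_extensions (T : Type) (P : seq T -> T -> Prop) :
  (forall s, exists t, P s t) ->
  exists a : nat -> T, forall n, P (mkseq a n) (a n).
Proof.
move=> /choice[g Pg].
pose s := fix s n := if n is n'.+1 then rcons (s n') (g (s n')) else [::].
exists (fun n => g (s n)) => n.
have <- : s n = mkseq (fun n => g (s n)) n; last exact: Pg.
by elim: n => // n IH; rewrite mkseqS -IH.
Qed.

Lemma filter_forall_mem (T : Type) (I : eqType) (F : set_system T)
    {FF : Filter F} (Q : I -> set T) (s : seq I) :
  (forall i, i \in s -> F (Q i)) ->
  F [set t | forall i, i \in s -> Q i t].
Proof.
elim: s => [_|i s IH FQ].
  by apply: filterS filterT.
have FQi : F (Q i) by apply: FQ; rewrite mem_head.
have {}IH : F [set t | forall i, i \in s -> Q i t].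
  by apply: IH => k ks; apply: FQ; rewrite in_cons ks orbT.
apply: filterS (filterI FQi IH) => t [Qit Qst] k /predU1P[->//|].
exact: Qst.
Qed.

(** A free ultrafilter containing [S] decides the colouring: each vertex has the
    same colour with almost all others, and almost all vertices agree on that
    colour. A homogeneous set is then built greedily, since each step meets
    finitely many conditions that hold almost everywhere. *)
Lemma infinite_ramsey (S : set nat) (c : rel nat) :
  (forall N, exists2 n, (N <= n)%N & S n) ->
  exists (b : bool) (a : nat -> nat),
    (forall n, S (a n)) /\
    (forall i n, (i < n)%N -> (a i < a n)%N /\ c (a i) (a n) = b).
Proof.
move=> Sinf.
have PF : ProperFilter (within S \oo).
  split; last exact: within_filter.
  move=> [N _ NS]; have [n Nn Sn] := Sinf N.
  exact: (NS n Nn Sn).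
have [U [UU sU]] := ultraFilterLemma PF.
have U_S : U S by apply: sU; exact: (@withinT _ \oo S).
have U_gt i : U [set m | (i < m)%N].
  by apply: sU; apply: (@cvg_within _ \oo); exact: nbhs_infty_gt.
have /choice[col U_col] n : exists b, U [set m | c n m = b].
  have [|h] := in_ultra_setVsetC [set m | c n m = true] UU; first by exists true.
  by exists false; apply: filterS h => m /negP/negbTE.
have [b U_b] : exists b, U [set n | col n = b].
  have [|h] := in_ultra_setVsetC [set n | col n = true] UU; first by exists true.
  by exists false; apply: filterS h => m /negP/negbTE.
(* The next term can be chosen only when the earlier ones have colour [b], so the
   step is conditional on it; the condition is discharged by induction. *)
have [a aP] : exists a : nat -> nat, forall n,
    (forall i, i \in mkseq a n -> col i = b) ->
    [/\ S (a n), col (a n) = b &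
      forall i, i \in mkseq a n -> (i < a n)%N /\ c i (a n) = b].
  apply: (@seq_of_finite_extensions _ (fun s t =>
    (forall i, i \in s -> col i = b) ->
    [/\ S t, col t = b & forall i, i \in s -> (i < t)%N /\ c i t = b])) => s.
  have [sb|nsb] := pselect (forall i, i \in s -> col i = b); last first.
    by exists 0%N.
  have /filter_ex[t [[St tb] ts]] : U ((S `&` [set n | col n = b]) `&`
      [set t | forall i, i \in s -> ((i < t)%N /\ c i t = b)]).
    apply: filterI; first exact: filterI.
    apply: (@filter_forall_mem _ _ _ _ (fun i => [set t | (i < t)%N /\ c i t = b])).
    move=> i /sb ib; apply: filterI (U_gt i) _.
    by rewrite -ib; exact: U_col.
  by exists t.
have col_a n : col (a n) = b.
  elim/ltn_ind: n => n IH; have [] // := aP n.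
  by move=> i /mapP[k]; rewrite mem_iota => /= kn ->; exact: IH.
have {aP} good n : [/\ S (a n), col (a n) = b &
      forall i, i \in mkseq a n -> (i < a n)%N /\ c i (a n) = b].
  by apply: aP => i /mapP[k _ ->].
exists b, a; split=> [n|i n ltin]; first by case: (good n).
by case: (good n) => _ _; apply; apply: map_f; rewrite mem_iota.
Qed.

(** A colouring of unordered pairs is read off [c] at the pairs [i < n]. The
    vertices are chosen one at a time: the extension property yields a new vertex
    with any prescribed adjacency to the previous ones. *)
Lemma embed_coloring (E c : rel nat) : random_graph E ->
  exists f : nat -> nat, forall i n, (i < n)%N ->
    f i != f n /\ E (f i) (f n) = c i n.
Proof.
move=> [[Esym _] Eext].
pose P s t := uniq s -> t \notin s /\
  forall i, (i < size s)%N -> E t (nth 0%N s i) = c i (size s).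
have [a aP] : exists a : nat -> nat, forall n, P (mkseq a n) (a n).
  apply: seq_of_finite_extensions.
  move=> s; have [us|nus] := pselect (uniq s); last by exists 0%N => /nus.
  pose F := [fset k in s | c (index k s) (size s)]%fset.
  pose G := [fset k in s | ~~ c (index k s) (size s)]%fset.
  have FG : [disjoint F & G]%fset.
    apply/fdisjointP => k; rewrite !inE/= => /andP[_ ck].
    by rewrite ck andbF.
  have [t [tF tG EF EG]] := Eext F G FG.
  exists t => _; split=> [|i lti].
    apply/negP => ts; move: tF tG; rewrite !inE ts/=.
    by move=> /negP h /negP; apply; apply/negP.
  have is_ : nth 0%N s i \in s by rewrite mem_nth.
  have [ci|nci] := boolP (c i (size s)).
    by apply: EF; rewrite !inE is_/= index_uniq.
  by apply/negbTE/EG; rewrite !inE is_/= index_uniq.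
have {}aP n : uniq (mkseq a n) -> a n \notin mkseq a n /\
    forall i, (i < n)%N -> E (a n) (a i) = c i n.
  move=> /aP[an aE]; split=> // i ltin.
  by have := aE i; rewrite size_mkseq nth_mkseq//; exact.
have ua n : uniq (mkseq a n).
  elim: n => // n IH; rewrite mkseqS rcons_uniq IH andbT.
  by have [] := aP n IH.
exists a => i n ltin; have [an aE] := aP n (ua n).
split; last by rewrite Esym aE.
by apply: contraNneq an => <-; apply: map_f; rewrite mem_iota.
Qed.

(** * The ideal of sets with bounded finite sums *)

Lemma bsum_sub (R : realType) (V : normedModType R) (x : nat -> V) A B :
  A `<=` B -> bsum x B -> bsum x A.
Proof. by move=> AB [k k0 kB]; exists k => // F /subset_trans/(_ AB)/kB. Qed.

Lemma bsum_is_ideal (R : realType) (V : normedModType R) (x : nat -> V) :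
  is_ideal (bsum x).
Proof.
split; last 2 first.
- exact: bsum_sub.
- move=> A B [k k0 kA] [l l0 lB]; exists (k + l); first exact: addr_gt0.
  move=> F FAB; rewrite (big_fsetID _ (mem A))/=.
  apply: le_trans (ler_normD _ _) _; apply: lerD.
    by apply: kA => n /=; rewrite !inE/= => /andP[_ /set_mem].
  apply: lB => n /=; rewrite !inE/= => /andP[nF /negP nA].
  by case: (FAB n nF) => // An; case: nA; exact/mem_set.
exists 1 => // F F0; rewrite big_seq big_pred0 ?normr0// => n.
by apply/negP => /F0.
Qed.

Lemma bsum_bounded_indices (R : realType) (V : normedModType R) (x : nat -> V) A N :
  (forall n, A n -> (n < N)%N) -> bsum x A.
Proof.
elim: N A => [|N IH] A AN.
  have [bsum0 _ _] := bsum_is_ideal x; apply: bsum_sub bsum0.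
  by move=> n /AN.
have [_ _ bsumU] := bsum_is_ideal x.
apply: bsum_sub (bsumU [set n | (n < N)%N] [set N] _ _); last 2 first.
- exact: IH.
- exists (`|x N| + 1) => [|F FN]; first by rewrite ltr_wpDl.
  have [NF|NF] := boolP (N \in F); last first.
    rewrite big_seq big_pred0 ?normr0 ?addr_ge0// => n.
    by apply/negP => nF; move: NF; rewrite -(FN n nF)/= nF.
  have -> : F = [fset N]%fset.
    apply/fsetP => n; rewrite !inE; apply/idP/eqP => [/FN//|->//].
  by rewrite big_seq_fset1 lerDl.
by move=> n /AN; rewrite ltnS leq_eqVlt => /predU1P[->|]; [right|left].
Qed.

(** The sets with preimage in [I] form an ideal, so that the generators of the
    random ideal are the only sets to test. *)
Lemma katetov_random_ideal (E : rel nat) (I : set (set nat)) (f : nat -> nat) :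
  is_ideal I ->
  (forall A, clique E A \/ independent E A -> I (f @^-1` A)) ->
  katetov_le (random_ideal E) I.
Proof.
move=> [I0 Isub IU] If; exists f => A.
apply: (smallest_sub (X := [set A | I (f @^-1` A)])) => //; split=> //=.
- by move=> B C BC; apply: Isub => n; exact: BC.
- by move=> B C IB IC; exact: IU.
Qed.

(** * A Katetov reduction forces weak nullity *)

Lemma weakly_nullP (R : realType) (V : normedModType R) (x : nat -> V) :
  weakly_null x <->
  forall phi : dual V, (fun n => sval phi (x n) : R) @ \oo --> (0 : R).
Proof.
rewrite /weakly_null cvg_sup; split=> h phi.
  have := @initial_continuous _ _ (sval phi) (0 : V).
  rewrite /continuous_at linear0 => c0.
  exact: cvg_comp (h phi) c0.
move=> A [_ [[B oB <-] /= B0 sBA]].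
have /(h phi) : nbhs (0 : R) B.
  by apply: open_nbhs_nbhs; split=> //; move: B0; rewrite /= linear0.
move=> xB; apply: (@filterS _ \oo _ [set n | B (sval phi (x n))]) xB.
by move=> n /= Bn; exact: sBA.
Qed.

Definition dual_opp (R : realType) (V : normedModType R) (phi : dual V) : dual V.
Proof.
exists (\- sval phi); move=> y.
by apply: cvgN; exact: (svalP phi).
Defined.

(** One-sided bounds suffice since the dual is closed under opposites; they keep
    all the values of [phi] on a homogeneous set of the same sign. *)
Lemma weakly_null_ltP (R : realType) (V : normedModType R) (x : nat -> V) :
  (forall (phi : dual V) (e : R), 0 < e ->
     \forall n \near \oo, (sval phi (x n) : R) < e) ->
  weakly_null x.
Proof.
move=> h; apply/weakly_nullP => phi; apply/cvgrPdist_lt => e e0.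
apply: filterS2 (h phi e e0) (h (dual_opp phi) e e0) => n /= lt1 lt2.
by rewrite sub0r normrN ltr_norml lt1 andbT ltrNl.
Qed.

Lemma dual_norm_le (R : realType) (V : normedModType R) (phi : dual V) :
  exists2 C : R, 0 < C & forall y, (sval phi y : R) <= C * `|y|.
Proof.
case: phi => f fc /=.
have /linear_boundedP := continuous_linear_bounded 0 (fc 0).
move=> /pinfty_ex_gt0[C C0 fC]; exists C => // y.
exact: le_trans (ler_norm _) (fC y).
Qed.

(** Sets homogeneous for the pulled-back colouring have images that are cliques or
    independent sets, so they have bounded sums; an infinite one on which a
    functional is at least [e] would give sums of [N] terms of norm at least a
    multiple of [N * e]. *)
Lemma weakly_null_of_katetov (R : realType) (V : normedModType R) (E : rel nat)
    (x : nat -> V) :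
  symmetric E -> katetov_le (random_ideal E) (bsum x) -> weakly_null x.
Proof.
move=> Esym [f fP]; apply: weakly_null_ltP => phi e e0; apply: contrapT => phix.
(* Equal images are coloured like edges, as [f] need not be injective. *)
have [|b [a [aS aP]]] := @infinite_ramsey [set n | e <= (sval phi (x n) : R)]
    (fun m n => (f m == f n) || E (f m) (f n)).
  move=> N; apply: contrapT => nS; apply: phix; exists N => // n Nn.
  by rewrite /= ltNge; apply/negP => en; apply: nS; exists n.
have a_inj : injective a.
  move=> i n ain; apply/eqP; case: ltngtP => // lt_; have [+ _] := aP _ _ lt_.
    by rewrite ain ltnn.
  by rewrite ain ltnn.
have hom : clique E (f @` range a) \/ independent E (f @` range a).
  have colored i n : f (a i) != f (a n) -> E (f (a i)) (f (a n)) = b.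
    move=> /negbTE fain; have [lt_in|lt_ni|ein] := ltngtP i n.
    - by have [_] := aP _ _ lt_in; rewrite fain.
    - by have [_] := aP _ _ lt_ni; rewrite eq_sym fain Esym.
    - by rewrite ein eqxx in fain.
  case: b {aP} colored => colored; [left|right] => u v;
    by move=> [_ [i _ <-] <-] [_ [n _ <-] <-] /colored ->.
have [k k0 kP] : bsum x (range a).
  apply: bsum_sub (fP (f @` range a) _); first exact: preimage_image.
  exact: sub_gen_smallest.
have [C C0 phiC] := dual_norm_le phi.
pose N := (Num.truncn (C * k / e)).+1.
pose F := [fset a (i : 'I_N) | i in 'I_N]%fset.
have FA : [set` F] `<=` range a by move=> _ /imfsetP[i _ ->]; exists i.
have : e *+ N <= C * k.
  apply: le_trans (_ : _ <= (sval phi (\sum_(n <- F) x n) : R)) _.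
    rewrite linear_sum big_seq /=.
    have -> : e *+ N = \sum_(n <- F | n \in F) e.
      rewrite -big_seq big_const_seq count_predT iter_addr_0.
      by rewrite card_imfset/= -?cardE ?card_ord// => i j /a_inj/val_inj.
    by apply: ler_sum => n /imfsetP[i _ ->]; exact: aS.
  by apply: le_trans (phiC _) _; rewrite ler_pM2l//; exact: kP.
apply/negP; rewrite -ltNge -mulr_natl -ltr_pdivrMr//.
exact: truncnS_gt.
Qed.

(** * Weakly null sequences in [c0] are bounded and null in each coordinate *)

(** The functionals [y |-> sum_k 2^-k y(j_k)], for an arbitrary sequence [j] of
    coordinates, are elements of the dual of [c0] rich enough to test with: a
    constant [j] gives the evaluation at a coordinate, up to a factor [2], and a
    sequence [j] of peaks of the [x_n] detects unboundedness. *)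
Section coordinate_functional.
Variables (R : realType) (j : nat -> nat).
Implicit Types y : c0 R.

Definition half_weighted y : R^nat := fun k => 2^-1 ^+ k * (y (j k) : R).

Definition coord_functional y : R^o := limn (series (half_weighted y)).

Lemma norm_half_lt1 : `|2^-1 : R| < 1.
Proof. by rewrite ger0_norm ?invr_ge0// invf_lt1// ltr1n. Qed.

Lemma half_weighted_le y (M : R) k :
  `|y (j k) : R| <= M -> `|half_weighted y k| <= geometric M 2^-1 k.
Proof.
move=> yM; rewrite /half_weighted /geometric/= normrM mulrC.
by rewrite (ger0_norm (exprn_ge0 _ _)) ?invr_ge0// ler_wpM2r// exprn_ge0// invr_ge0.
Qed.

Lemma series_geometric_le (M : R) n :
  0 <= M -> series (geometric M 2^-1) n <= 2 * M.
Proof.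
move=> M0; have half1 : (2^-1 : R) != 1 by rewrite lt_eqF// invf_lt1// ltr1n.
rewrite geometric_seriesE//= ler_pdivrMr ?subr_gt0 ?invf_lt1 ?ltr1n//.
rewrite mulrBr mulr1 (_ : 2 * M * _ = M); last by field.
by rewrite lerBlDr lerDl mulr_ge0// exprn_ge0// invr_ge0.
Qed.

Lemma half_weighted_cvg y : cvgn (series (half_weighted y)).
Proof.
apply: normed_cvg; apply: (@series_le_cvg _ _ (geometric `|y| 2^-1)).
- by move=> n; exact: normr_ge0.
- by move=> n; apply: geometric_ge0; rewrite ?normr_ge0 ?invr_ge0.
- by move=> n; apply: half_weighted_le; exact: c0_norm_ub.
- exact/is_cvg_geometric_series/norm_half_lt1.
Qed.

Lemma coord_functional_is_linear : linear coord_functional.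
Proof.
move=> a y z; rewrite /coord_functional.
have -> : half_weighted (a *: y + z) = a *: half_weighted y + half_weighted z.
  apply/funext => k; rewrite !fctE /half_weighted.
  have -> : (a *: y + z) (j k) = a * (y (j k) : R) + z (j k) by [].
  by rewrite mulrDr mulrCA.
have cay : cvgn (series (a *: half_weighted y)).
  by apply: is_cvg_seriesZ; exact: half_weighted_cvg.
rewrite (lim_seriesD cay (@half_weighted_cvg z)) lim_seriesZ//.
exact: half_weighted_cvg.
Qed.

HB.instance Definition _ := GRing.isLinear.Build R (c0 R) R^o *:%R
  coord_functional coord_functional_is_linear.

Lemma coord_functional_continuous : continuous coord_functional.
Proof.
apply/linear_bounded_continuous/linear_boundedP.
near=> C => y; apply: (@le_trans _ _ (2 * `|y|)).
  rewrite /coord_functional -(lim_norm (@half_weighted_cvg y)).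
  apply: limr_le; first exact: (is_cvg_norm (@half_weighted_cvg y)).
  near=> n; apply: le_trans (series_geometric_le n (normr_ge0 y)).
  apply: le_trans (ler_norm_sum _ _ _) _; apply: ler_sum => k _.
  apply: half_weighted_le; exact: c0_norm_ub.
by rewrite ler_wpM2r.
Unshelve. all: end_near. Qed.

(** The [k]-th term dominates: the others contribute at most [sum_i 2^-i = 2]. *)
Lemma coord_functional_ge y k :
  (forall i, i != k -> `|y (j i) : R| <= 1) ->
  2^-1 ^+ k * `|y (j k) : R| - 2 <= `|coord_functional y|.
Proof.
move=> y1; rewrite /coord_functional -(lim_norm (@half_weighted_cvg y)).
apply: limr_ge; first exact: (is_cvg_norm (@half_weighted_cvg y)).
near=> n; have kn : (k < n)%N by near: n; exact: nbhs_infty_gt.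
rewrite /series/= big_mkord (bigD1 (Ordinal kn))//=.
rewrite lerBlDr; apply: le_trans (_ : `|half_weighted y k| <= _).
  by rewrite normrM ger0_norm// exprn_ge0// invr_ge0.
rewrite -[X in `|X| <= _](addrK (\sum_(i < n | i != Ordinal kn) half_weighted y i)).
apply: le_trans (ler_normB _ _) _; rewrite lerD2l.
have le2 := series_geometric_le n (@ler01 R).
rewrite mulr1 in le2; apply: le_trans le2.
apply: le_trans (ler_norm_sum _ _ _) _.
rewrite /series/= big_mkord [leRHS](bigID (fun i => i != Ordinal kn))/=.
rewrite ler_wpDr//.
  by apply: sumr_ge0 => i _; apply: geometric_ge0; rewrite ?invr_ge0.
by apply: ler_sum => i ik; apply: half_weighted_le; exact: y1.
Unshelve. all: end_near. Qed.

End coordinate_functional.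

Definition coord_dual (R : realType) (j : nat -> nat) : dual (c0 R) :=
  exist _ (coord_functional j : {linear c0 R -> R^o})
    (@coord_functional_continuous R j).

Lemma coord_functional_cst (R : realType) i (y : c0 R) :
  coord_functional (fun=> i) y = 2 * (y i : R).
Proof.
have -> : 2 * (y i : R) = y i * (1 - 2^-1)^-1.
  by rewrite (_ : 1 - 2^-1 = 2^-1 :> R) ?invrK 1?mulrC//; lra.
rewrite /coord_functional.
have <- : geometric (y i : R) 2^-1 = half_weighted (fun=> i) y.
  by apply/funext => k; rewrite /half_weighted mulrC.
apply: cvg_lim => //; exact/cvg_geometric_series/norm_half_lt1.
Qed.

Lemma weakly_null_coord (R : realType) (x : nat -> c0 R) i :
  weakly_null x -> (fun n => x n i : R) @ \oo --> (0 : R).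
Proof.
move=> /weakly_nullP/(_ (coord_dual R (fun=> i)))/= phix.
have -> : (fun n => x n i : R) =
    (fun n => 2^-1 * (coord_functional (fun=> i) (x n) : R)).
  by apply/funext => n; rewrite coord_functional_cst mulKf// pnatr_eq0.
rewrite -(mulr0 (2^-1 : R)); apply: cvgM => //; exact: cvg_cst.
Qed.

Lemma unbounded_tail (R : realDomainType) (u : nat -> R) (M : R) N :
  (forall n, 0 <= u n) -> (forall C, exists n, C < u n) ->
  exists2 n, (N <= n)%N & M < u n.
Proof.
move=> u0 /(_ (Num.max M (\sum_(i < N) u i)))[n].
rewrite gt_max => /andP[Mn sumn]; exists n => //.
rewrite leqNgt; apply/negP => nN.
move: sumn; rewrite (bigD1 (Ordinal nN))//= ltNge => /negP; apply.
by rewrite lerDl sumr_ge0.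
Qed.

(** Gliding hump, in place of the uniform boundedness principle. If the norms
    are unbounded, choose pairs [(n_k, j_k)], with [n_k] increasing, such that
    [x_(n_k)] exceeds [3 * 2^k] at [j_k], whereas it is at most [1] at all the
    other [j_i]. The functional with the coordinates [j_k] then has absolute
    value at least [3 - 2] at each [x_(n_k)], so that it does not tend to [0]
    along [x]. *)
Lemma weakly_null_bounded (R : realType) (x : nat -> c0 R) :
  weakly_null x -> exists C : R, forall n i, `|x n i : R| <= C.
Proof.
move=> x0; apply: contrapT => unb.
have {}unb C : exists n, C < `|x n|.
  apply: contrapT => nC; apply: unb; exists C => n i.
  apply: le_trans (c0_norm_ub (x n) i) _.
  by rewrite leNgt; apply/negP => Cn; apply: nC; exists n.
have small_row (p : nat * nat) : \forall i \near \oo, `|x p.1 i : R| <= 1.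
  by have /cvgr0_norm_le := @c0_cvg _ (x p.1); apply.
have small_col i : \forall n \near \oo, `|x n i : R| <= 1.
  by have /cvgr0_norm_le := @weakly_null_coord _ _ i x0; apply.
pose P (s : seq (nat * nat)) (t : nat * nat) :=
  (forall p, p \in s -> [/\ (p.1 < t.1)%N, `|x t.1 p.2 : R| <= 1 &
                            `|x p.1 t.2 : R| <= 1]) /\
  2 ^+ size s * 3 < `|x t.1 t.2 : R|.
have [a aP] : exists a : nat -> nat * nat, forall n, P (mkseq a n) (a n).
  apply: seq_of_finite_extensions => s.
  have [J _ JP] : \forall i \near \oo, forall p, p \in s -> `|x p.1 i : R| <= 1.
    by apply: filter_forall_mem => p _; exact: small_row.
  have cols : \forall n \near \oo,
      forall i, i \in iota 0 J ++ map snd s -> `|x n i : R| <= 1.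
    by apply: filter_forall_mem => i _; exact: small_col.
  have later : \forall n \near \oo, forall p, p \in s -> (p.1 < n)%N.
    by apply: filter_forall_mem => p _; exact: nbhs_infty_gt.
  have [N _ NP] := filterI cols later.
  have [n Nn xn] :=
    unbounded_tail (2 ^+ size s * 3) N (fun n => normr_ge0 (x n)) unb.
  have [colsn latern] := NP n Nn.
  have [i xni] : exists i, 2 ^+ size s * 3 < `|x n i : R|.
    apply: contrapT => ni; move: xn; rewrite ltNge => /negP; apply.
    apply: c0_norm_le => i.
    by rewrite leNgt; apply/negP => xi; apply: ni; exists i.
  (* Before [J] all coordinates of [x n] are at most [1], so the peak is later. *)
  have Ji : (J <= i)%N.
    rewrite leqNgt; apply/negP => iJ.
    have : `|x n i : R| <= 1.
      by apply: colsn; rewrite mem_cat mem_iota iJ.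
    rewrite leNgt => /negP; apply; apply: le_lt_trans xni.
    apply: (@le_trans _ _ 3); first by rewrite ler1n.
    by rewrite ler_peMl// exprn_ege1// ler1n.
  exists (n, i); split=> //= p ps; split; first exact: latern.
    by apply: colsn; rewrite mem_cat; apply/orP; right; apply/mapP; exists p.
  exact: JP i Ji p ps.
have mem_mk i n : (i < n)%N -> a i \in mkseq a n.
  by move=> ltin; apply: map_f; rewrite mem_iota.
have /weakly_nullP/(_ (coord_dual R (fun k => (a k).2))) := x0.
move=> /cvgr0_norm_lt/(_ _ ltr01)[N _ NP].
have leN : (N <= (a N).1)%N.
  elim: (N) => // k IH; apply: leq_ltn_trans IH _.
  by have [/(_ _ (mem_mk _ _ (ltnSn k)))[]] := aP k.+1.
have := NP _ leN; rewrite /= ltNge => /negP; apply.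
apply: le_trans (coord_functional_ge (k := N) _); last first.
  move=> i; case: ltngtP => // lt_ _.
    by have [/(_ _ (mem_mk _ _ lt_))[]] := aP N.
  by have [/(_ _ (mem_mk _ _ lt_))[]] := aP i.
have [_] := aP N; rewrite size_mkseq => big.
rewrite lerBrDr (_ : 1 + 2 = 3)// exprVn ler_pdivlMl ?exprn_gt0//.
exact: ltW.
Qed.

(** * A colouring whose homogeneous sets have bounded sums *)

(** The bound [t] on the terms is used at most once: if the first term is larger
    than [2^-m], then all later ones are at most [2^-m], and this becomes the
    bound for the rest of the sum; otherwise the first term costs only [2^-m] and
    [t] is kept. In both cases the excess over [t] is paid by [sum_m 2^-m]. *)
Lemma sum_almost_disjoint (R : realFieldType) (u : nat -> R) (s : seq nat)
    (a : nat) (t : R) :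
  0 <= t ->
  pairwise ltn s ->
  {in s &, forall m n, (m < n)%N ->
     (u m <= 2^-1 ^+ m) || (u n <= 2^-1 ^+ m)} ->
  (forall n, n \in s -> (a <= n)%N /\ u n <= t) ->
  \sum_(n <- s) u n <= t + 2 * 2^-1 ^+ a.
Proof.
elim: s a t => [|m s IH] a t t0; first by rewrite big_nil addr_ge0.
rewrite pairwise_cons => /andP[/allP ms s_pw] dis st.
rewrite big_cons.
have [am um] := st m (mem_head _ _).
have dis_s : {in s &, forall i n, (i < n)%N ->
    (u i <= 2^-1 ^+ i) || (u n <= 2^-1 ^+ i)}.
  by move=> i n is_ ns; apply: dis; rewrite in_cons ?is_ ?ns orbT.
have pow0 k : 0 <= 2^-1 ^+ k :> R by rewrite exprn_ge0// invr_ge0.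
have powa : 2^-1 ^+ m <= 2^-1 ^+ a :> R.
  by apply: ler_wiXn2l => //; rewrite ?invr_ge0// invf_le1// ler1n.
have step : 2 * 2^-1 ^+ m.+1 = 2^-1 ^+ m :> R.
  by rewrite exprS mulrA divff ?mul1r// pnatr_eq0.
have [small|big] := leP (u m) (2^-1 ^+ m).
  have : \sum_(n <- s) u n <= t + 2 * 2^-1 ^+ m.+1.
    apply: IH => // n ns; split; first exact: ms.
    by have [] := st n (mem_behead (s := m :: s) ns).
  by rewrite step; lra.
have : \sum_(n <- s) u n <= 2^-1 ^+ m + 2 * 2^-1 ^+ m.+1.
  apply: IH => // n ns; split; first exact: ms.
  have := dis m n (mem_head _ _) (mem_behead (s := m :: s) ns) (ms n ns).
  by rewrite leNgt big.
by rewrite step; lra.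
Qed.

(** The threshold depends on the smaller index alone; that is why the relation
    holds for a fixed [m] and all large [n], however slowly the coordinates of
    [x n] tend to [0]. *)
Definition almost_disjoint (R : realType) (x : nat -> c0 R) : rel nat :=
  fun m n => `[< forall i, (`|x m i : R| <= 2^-1 ^+ m) ||
                           (`|x n i : R| <= 2^-1 ^+ m) >].

Lemma almost_disjoint_eventually (R : realType) (x : nat -> c0 R) m :
  (forall i, (fun n => x n i : R) @ \oo --> (0 : R)) ->
  \forall n \near \oo, almost_disjoint x m n.
Proof.
move=> x0; have pow0 : 0 < 2^-1 ^+ m :> R by rewrite exprn_gt0// invr_gt0.
have /cvgr0_norm_le/(_ _ pow0)[J _ JP] := @c0_cvg _ (x m).
have : \forall n \near \oo, forall i, i \in iota 0 J -> `|x n i : R| <= 2^-1 ^+ m.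
  by apply: filter_forall_mem => i _; have /cvgr0_norm_le := x0 i; apply.
apply: filterS => n nP; apply/asboolP => i.
have [Ji|iJ] := leqP J i; first by rewrite (JP i Ji).
by rewrite (nP i) ?orbT// mem_iota.
Qed.

Lemma bsum_almost_disjoint (R : realType) (x : nat -> c0 R) (C : R) A :
  (forall n i, `|x n i : R| <= C) ->
  (forall m n, A m -> A n -> (m < n)%N -> almost_disjoint x m n) ->
  bsum x A.
Proof.
move=> xC Adis.
have C0 : 0 <= C := le_trans (normr_ge0 (x 0%N 0%N : R)) (xC 0%N 0%N).
exists (C + 2) => [|F FA]; first by rewrite ltr_wpDl.
apply: c0_norm_le => i.
have -> : (\sum_(n <- F) x n) i = \sum_(n <- F) (x n i : R).
  by elim/big_rec2 : _ => // n y z _ <-.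
apply: le_trans (ler_norm_sum _ _ _) _.
rewrite -(perm_big _ (permEl (perm_sort leq F)))/=.
have := @sum_almost_disjoint R (fun n => `|x n i : R|) (sort leq F) 0 C C0.
rewrite expr0 mulr1; apply.
- rewrite -sorted_pairwise; last exact: ltn_trans.
  rewrite ltn_sorted_uniq_leq sort_uniq fset_uniq/=.
  exact: (sort_sorted leq_total).
- move=> m n; rewrite !mem_sort => /FA Am /FA An mn.
  by have /asboolP := Adis m n Am An mn; exact.
- by [].
Qed.

(** The reduction embeds the almost-disjointness graph into the random graph. *)
Lemma katetov_of_weakly_null (R : realType) (E : rel nat) (x : nat -> c0 R) :
  random_graph E -> weakly_null x -> katetov_le (random_ideal E) (bsum x).
Proof.
move=> rE x0; have [C xC] := weakly_null_bounded x0.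
have [f fP] := embed_coloring (almost_disjoint x) rE.
apply: (@katetov_random_ideal _ _ f); first exact: bsum_is_ideal.
move=> A [Acl|Aind].
  apply: (bsum_almost_disjoint xC) => m n Am An mn.
  by have [fmn <-] := fP m n mn; exact: Acl.
have [[a Aa]|nA] := pselect (exists a, A (f a)); last first.
  by apply: (@bsum_bounded_indices _ _ _ _ 0) => n An; case: nA; exists n.
have [N _ NP] := @almost_disjoint_eventually _ x a
  (fun i => @weakly_null_coord _ _ i x0).
apply: (@bsum_bounded_indices _ _ _ _ (maxn N a.+1)) => n An.
rewrite ltnNge geq_max; apply/negP => /andP[Nn an].
have [fan cE] := fP a n an.
by have := Aind _ _ Aa An fan; rewrite cE; apply/negP; rewrite negbK; exact: NP.
Qed.

Theorem theorem5p14 (R : realType) (E : rel nat) (x : nat -> c0 R) :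
  random_graph E ->
  (katetov_le (random_ideal E) (bsum x) <-> weakly_null x).
Proof.
move=> rE; split; last exact: katetov_of_weakly_null.
by apply: weakly_null_of_katetov; case: rE => -[].
Qed.
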